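(* Let $f \in l^{1}(\mathbb{Z})$, let $C>1$ be a real number, and let $$S_C:=\Big\{n\in\mathbb{Z}:\ \frac{|n|}{2C}\leq\mathcal{F}f(n) \leq \frac{|n|}{C}\Big\},$$ where $\mathcal{F}f$ is the discrete frequency function of $f$. Then the set $S_C$ is finite.
   Context: $\mathbb{Z}^+$ denotes the set of non-negative integers (including $0$). $l^1(\mathbb{Z})$ is the space of absolutely summable (real- or complex-valued) functions on $\mathbb{Z}$. For $f\in l^1(\mathbb{Z})$, $n\in\mathbb{Z}$ and $r\in\mathbb{Z}^+$ put $$\mathcal{A}_rf(n):=\frac{1}{2r+1}\sum_{k=-r}^{r}|f(n+k)|,\qquad \mathcal{M}f(n):=\sup_{r\in\mathbb{Z}^+}\mathcal{A}_rf(n),$$ $$E_{f,n}:=\{r\in\mathbb{Z}^+:\ \mathcal{M}f(n)=\mathcal{A}_rf(n)\}.$$ The set $E_{f,n}$ is always non-empty, and the discrete frequency function is $\mathcal{F}f(n):=\inf E_{f,n}$, i.e. the smallest $r\in\mathbb{Z}^+$ for which the supremum defining $\mathcal{M}f(n)$ is attained. *)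

(* Defs.v *)
From mathcomp Require Import all_boot all_order all_algebra.
From mathcomp Require Import all_classical all_reals all_analysis.
From mathcomp.real_closed Require Import complex.

Set Implicit Arguments.
Unset Strict Implicit.
Unset Printing Implicit Defensive.

Import Order.TTheory GRing.Theory Num.Theory.
Import numFieldNormedType.Exports.

Local Open Scope classical_set_scope.
Local Open Scope ring_scope.

Section frequency.
(* The values of f enter only through `|f n| : R, so scalars range over a type
   V normed over R; V := R gives real-valued functions, and V := Rcomplex R
   (R[i] with its R-valued modulus) gives complex-valued ones. *)
Context {R : realType} {V : normedZmodType R}.
Implicit Types (f : int -> V) (n : int) (r : nat).

Definition l1 f : Prop := summable [set: int] (fun n => `|f n|%:E).

(* The window -r <= k <= r is enumerated as k = i - r with 0 <= i < 2r + 1. *)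
Definition average f r n : R :=
  (2 * r + 1)%:R^-1 * \sum_(i < 2 * r + 1) `|f (n + (i%:Z - r%:Z))|.

(* [sup] is the supremum for sets that are nonempty and bounded above, as here
   when f is in l1. *)
Definition maximal f n : R := sup [set average f r n | r in [set: nat]].

Definition attaining_radii f n : set nat :=
  [set r | maximal f n = average f r n].

(* The infimum is taken in R; for f in l1 the set is a nonempty set of
   naturals, so this is (the image in R of) its least element. *)
Definition frequency f n : R := inf [set r%:R | r in attaining_radii f n].

Definition frequency_band f (C : R) : set int :=
  [set n | `|n|%:~R / (2 * C) <= frequency f n <= `|n|%:~R / C].

End frequency.

(* Main.v *)
Require Import Defs.
From mathcomp Require Import all_boot all_order all_algebra.
From mathcomp Require Import all_classical all_reals all_analysis.
From mathcomp.real_closed Require Import complex.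
From mathcomp Require Import zify lra.

Import Order.TTheory GRing.Theory Num.Theory.
Local Open Scope ring_scope.

(* Fix x0 with f x0 <> 0. The window of radius |n| + |x0| around n contains x0,
   so M f n >= |f x0| / (2 |n| + 2 |x0| + 1). If r <= |n| / C attains the
   supremum at n, the window of radius r stays at distance (1 - 1/C) |n| from
   the origin and carries only a small mass e of f; with |n| / (2C) <= r this
   gives M f n <= C e / |n|, which is impossible for |n| large. *)

Section NormedValued.
Context {R : realType} {V : normedZmodType R}.
Implicit Types (f : int -> V) (n : int) (r : nat) (s : seq int).

(** A duplicate-free list, so that sums over windows fall under bounds on sums over arbitrary [uniq]
    lists. *)
Definition window n r : seq int :=
  [seq n + (i%:Z - r%:Z) | i <- iota 0 (2 * r + 1)].

Lemma window_uniq n r : uniq (window n r).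
Proof. by rewrite map_inj_uniq ?iota_uniq // => i j /=; lia. Qed.

Lemma mem_window n r (x : int) : (x \in window n r) = (`|x - n| <= r)%N.
Proof.
apply/mapP/idP => [[k]|xr]; first by rewrite mem_iota => /andP[_ kr] ->; lia.
by exists (absz (x - n + r%:Z)); rewrite ?mem_iota; lia.
Qed.

Lemma averageE f r n :
  average f r n = (2 * r + 1)%:R^-1 * \sum_(x <- window n r) `|f x|.
Proof.
rewrite /average /window big_map -[X in iota 0 X]subn0.
by rewrite -/(index_iota 0 _) big_mkord.
Qed.

(** All later uses of summability go through this real-valued bound on finite sums. *)
Lemma l1_bounded_sums f : l1 f ->
  exists M : R, forall s, uniq s -> \sum_(x <- s) `|f x| <= M.
Proof.
rewrite /l1 /summable.
set T := esum _ _ => Tfin.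
exists (fine T) => s us.
have sT : ((\sum_(x <- s) `|f x|)%:E <= T)%E.
  apply: ereal_sup_ubound; exists [set` s]%classic.
    by split => //; exact: finite_seq.
  rewrite -fsbig_seq // -sumEFin; apply: eq_bigr => x _.
  by rewrite abse_EFin normr_id.
rewrite -lee_fin fineK // ge0_fin_numE //.
by apply: esum_ge0 => x _; exact: abse_ge0.
Qed.

(** Take a finite [s0] whose sum is within [e] of the supremum of all finite sums. A list disjoint
    from [s0] can add at most [e], and taking [K] as the largest absolute value in [s0] forces
    disjointness. *)
Lemma l1_tail f (e : R) : l1 f -> 0 < e ->
  exists K : nat, forall s, uniq s -> {in s, forall x, (K < `|x|)%N} ->
    \sum_(x <- s) `|f x| <= e.
Proof.
move=> /l1_bounded_sums[M fM] e0.
pose P := [set \sum_(x <- s) `|f x| | s in [set s | uniq s]]%classic.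
have supP : has_sup P.
  split; first by exists (\sum_(x <- [::]) `|f x|), [::].
  by exists M => _ [s us <-]; exact: fM.
have [_ [s0 us0 <-] s0P] := sup_adherent e0 supP.
exists (\max_(x <- s0) `|x|)%N => s us sK.
have us0s : uniq (s0 ++ s).
  rewrite cat_uniq us0 us andbT; apply/hasPn => x /sK xK.
  apply/negP => xs0; move: xK; rewrite ltnNge => /negP; apply.
  exact: leq_bigmax_seq.
have : \sum_(x <- s0 ++ s) `|f x| <= sup P.
  by apply: sup_upper_bound => //; exists (s0 ++ s).
by rewrite big_cat /=; lra.
Qed.

Lemma average_le_maximal f n r : l1 f -> average f r n <= maximal f n.
Proof.
move=> /l1_bounded_sums[M fM]; apply: sup_upper_bound; last by exists r.
split; first by exists (average f r n), r.
exists M => _ [k _ <-]; rewrite averageE.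
have k1 : 1 <= (2 * k + 1)%:R :> R by rewrite ler1n; lia.
rewrite mulrC ler_pdivrMr; last exact: lt_le_trans k1.
rewrite (le_trans (fM _ (window_uniq n k))) // ler_peMr //.
(* The empty list shows that [M] is nonnegative. *)
by have := fM [::] isT; rewrite big_nil.
Qed.

(* An empty set of radii would have infimum 0 by convention. *)
Lemma frequency_min f n : frequency f n != 0 ->
  exists r, [/\ frequency f n = r%:R, maximal f n = average f r n &
    forall k, maximal f n = average f k n -> (r <= k)%N].
Proof.
rewrite /frequency => F0.
have [r0 Er0] : exists r, attaining_radii f n r.
  apply/not_existsP => E0; move/eqP: F0; apply.
  suff -> : attaining_radii f n = set0 by rewrite image_set0 inf0.
  by apply/seteqP; split => // r /E0.
have exE : exists r, `[< attaining_radii f n r >] by exists r0; apply/asboolP.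
case: (ex_minnP exE) => r /asboolP Er rmin; exists r.
have rle k : attaining_radii f n k -> (r <= k)%N by move=> /asboolP /rmin.
split=> //; apply/eqP; rewrite eq_le; apply/andP; split.
  apply: ge_inf; last by exists r.
  by exists 0 => _ [k _ <-]; exact: ler0n.
apply: lb_le_inf; first by exists r%:R, r.
by move=> _ [k /rle rk <-]; rewrite ler_nat.
Qed.

Lemma finite_absz_le (N : nat) : finite_set [set n : int | (`|n| <= N)%N]%classic.
Proof.
apply: (sub_finite_set _ (finite_seq (window 0 N))) => n /= nN.
by rewrite mem_window subr0.
Qed.

(** For nonzero [n] the lower bound of the band is positive, so the frequency is not the default
    value 0 and is an attained radius. *)
Lemma frequency_band_radius f n (C : R) : 1 < C -> frequency_band f C n ->
  n != 0 -> exists r, [/\ maximal f n = average f r n,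
    forall k, maximal f n = average f k n -> (r <= k)%N, (0 < r)%N,
    `|n|%N%:R <= 2 * C * r%:R & C * r%:R <= `|n|%N%:R].
Proof.
move=> C1 /andP[]; rewrite -abszE -[_%:~R]/(`|n|%N%:R) => lo hi n0.
have C0 : 0 < C by lra.
have C20 : 0 < 2 * C by lra.
have npos : 0 < `|n|%N%:R :> R by rewrite ltr0n absz_gt0.
have F0 : 0 < frequency f n by apply: lt_le_trans lo; exact: divr_gt0.
have [r [Fr Mr rmin]] := frequency_min f n (lt0r_neq0 F0).
move: lo hi F0; rewrite Fr ler_pdivrMr // ler_pdivlMr // => lo hi r0.
exists r; split => //; first by move: r0; rewrite ltr0n.
- by rewrite mulrC.
- by rewrite mulrC.
Qed.

Lemma maximal_ge f n (x0 : int) : l1 f ->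
  `|f x0| / (2 * (`|n| + `|x0|) + 1)%:R <= maximal f n.
Proof.
move=> fl1; apply: le_trans (average_le_maximal f n (`|n| + `|x0|)%N fl1).
rewrite averageE mulrC ler_wpM2l ?invr_ge0 ?ler0n //.
have x0w : x0 \in window n (`|n| + `|x0|) by rewrite mem_window; lia.
by rewrite (bigD1_seq x0) ?window_uniq //= lerDl sumr_ge0.
Qed.

Theorem finite_frequency_band f (C : R) : 1 < C -> l1 f ->
  finite_set (frequency_band f C).
Proof.
move=> C1 fl1; have C0 : 0 < C by lra.
have [f0|/existsNP[x0 /eqP fx0]] := pselect (forall x, f x = 0).
  (* If [f] vanishes, every radius attains the supremum, so the least one is 0 and no nonzero [n]
     lies in the band. *)
  apply: sub_finite_set (finite_absz_le 0) => n bn /=.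
  have [->//|n0] := eqVneq n 0.
  have [r [Mr rmin r0 _ _]] := frequency_band_radius f n C C1 bn n0.
  have avg0 k : average f k n = 0.
    by rewrite /average big1 ?mulr0 // => i _; rewrite f0 normr0.
  by have := rmin 0%N; rewrite Mr !avg0 => /(_ erefl); lia.
set a := `|f x0|; have a0 : 0 < a by rewrite normr_gt0.
(* The 4 is chosen to beat the 3 in [D1]. *)
have e0 : 0 < a / (4 * C) by apply: divr_gt0 => //; lra.
have [K tailK] := l1_tail f _ fl1 e0.
(* If the window met [[-K, K]], then [m <= K + r] and [C * r <= m] would give
   [m * (C - 1) <= K * C], against [B < m]. The term [2 * |x0| + 1] in [N] serves [D1]. *)
pose B := K.+1%:R * C / (C - 1).
pose N := (2 * `|x0| + 1 + Num.bound B)%N.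
apply: sub_finite_set (finite_absz_le N) => n bn /=.
rewrite leqNgt; apply/negP => Nn.
have n0 : n != 0 by lia.
have [r [Mr _ r0 lo hi]] := frequency_band_radius f n C C1 bn n0.
set m : R := `|n|%N%:R in lo hi.
have mB : B < m.
  apply: le_lt_trans (ler_norm _) _; apply: lt_trans (archi_boundP (normr_ge0 _)) _.
  have -> : Num.bound `|B| = Num.bound B by rewrite /Num.bound normr_id.
  by rewrite ltr_nat; lia.
have far x : x \in window n r -> (K < `|x|)%N.
  rewrite mem_window => xr; rewrite ltnNge; apply/negP => xK.
  have : (`|n| <= K + r)%N by lia.
  rewrite -(ler_nat R) natrD -/m => mKr.
  move: mB; rewrite /B ltr_pdivrMr ?subr_gt0 // -natr1.
  by nra.
have small := tailK _ (window_uniq n r) far.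
have := maximal_ge f n x0 fl1; rewrite Mr averageE -/a.
set S := \sum_(x <- _) _ in small *.
have d1 : 0 < (2 * (`|n| + `|x0|) + 1)%:R :> R by rewrite ltr0n; lia.
have d2 : 0 < (2 * r + 1)%:R :> R by rewrite ltr0n; lia.
rewrite [X in _ <= X]mulrC ler_pdivrMr // mulrAC ler_pdivlMr // => key.
have D1 : (2 * (`|n| + `|x0|) + 1)%:R <= 3 * m.
  by rewrite -[3]/(3%:R) -natrM ler_nat; lia.
have D2 : m <= C * (2 * r + 1)%:R by rewrite natrD natrM; nra.
have m0 : 0 < m by rewrite ltr0n; lia.
have S0 : 0 <= S by rewrite sumr_ge0.
have S4 : S * (4 * C) <= a by rewrite -ler_pdivlMr //; lra.
have k1 : a * (2 * r + 1)%:R <= S * (3 * m).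
  by apply: le_trans key _; rewrite ler_wpM2l.
have k2 : a * m <= C * (S * (3 * m)).
  apply: (@le_trans _ _ (C * (a * (2 * r + 1)%:R))); last by rewrite ler_pM2l.
  by rewrite mulrCA ler_pM2l.
have k3 : S * (4 * C) * m <= a * m by rewrite ler_pM2r.
have am0 : 0 < a * m by exact: mulr_gt0.
(* Together, [4 * C * S * m <= a * m <= 3 * C * S * m] forces [C * S * m <= 0], hence
   [a * m <= 0]. *)
by nra.
Qed.

End NormedValued.

Theorem theorem1 (R : realType) (C : R) (C_gt1 : 1 < C) :
  (forall f : int -> R, l1 f -> finite_set (frequency_band f C)) /\
  (forall f : int -> Rcomplex R, l1 f -> finite_set (frequency_band f C)).
Proof. by split=> f; exact: finite_frequency_band. Qed.
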